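(* For each of the Kähler, almost Kähler and Spin$^c$ quantizations, every polarized section $s\in\mathcal H_k$ satisfies, for all $x\in M$, $$|s(x)|\le\|s\|\sqrt{\varepsilon^{(k)}(x)},$$ where $\varepsilon^{(k)}(x)=\sum_{j=1}^{d_k}|\theta^{(k)}_j(x)|^2$ is the coherent density.
   Context: Setting. $(M,\omega)$ is a compact symplectic manifold of dimension $2n$ with $[\omega/2\pi]$ integral; $\ell\to M$ is a Hermitian line bundle with compatible connection $\nabla$ of curvature $-i\omega$; $\ell^{\otimes k}$ carries the induced Hermitian structure $h$ (conjugate linear in the first argument) and connection. $\epsilon_\omega=(2\pi)^{-n}\omega^{\wedge n}/n!$. $J$ is an $\omega$-compatible almost complex structure, $g=\omega(\cdot,J\cdot)$, $TM_{\mathbb C}=TM^{(1,0)}\oplus TM^{(0,1)}$ is the $\pm i$-eigenspace decomposition, and $d_k=\int_M \mathrm{ch}(\ell^{\otimes k})\,\mathrm{Td}(TM^{(1,0)})$. For sections $s_1,s_2$, $\langle s_1|s_2\rangle=\int_M h(s_1,s_2)\,\epsilon_\omega$, $\|s\|^2=\langle s|s\rangle$, and $|s(x)|^2=h(s(x),s(x))$. Quantizations. The bundle $L^k$ and the quantum Hilbert space $\mathcal H_k\subset L^2(M,L^k)$, with $\dim\mathcal H_k=d_k<\infty$ and consisting of smooth sections, are one of the following. (i) Kähler ($J$ integrable): $L^k=\ell^{\otimes k}$ and $\mathcal H_k$ is the space of sections $s$ with $\nabla_Xs=0$ for all $X\in\Gamma(TM^{(0,1)})$ (holomorphic sections). (ii)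 Almost Kähler: $L^k=\ell^{\otimes k}$ and $\mathcal H_k$ is the span of orthonormal eigensections for the first $d_k$ eigenvalues (in nondecreasing order, with multiplicity) of $\Delta_k=\Delta-nk$, where $\Delta$ is the Laplacian on sections of $\ell^{\otimes k}$ for $g$ and $\nabla$. (iii) Spin$^c$: $L^k=\Lambda^{0,*}(T^*M)\otimes\ell^{\otimes k}$ with the Hermitian structure $h$ induced by $g$ and $h$, and $\mathcal H_k=\ker D_+\ominus\ker D_-$, where $D_\pm$ are the even/odd parts of the Spin$^c$ Dirac operator on $L^k$ determined by $(J,g,\nabla)$. Throughout $k$ is large enough that the relevant vanishing/existence theorem holds (in (i), $\dim\mathcal H_k=d_k$; in (ii), with constants $a>0$ and $C$ independent of $k$, the first $d_k$ eigenvalues of $\Delta_k$ lie in $(-a,a)$ and the others lie to the right of $nk+C$; in (iii), $\ker D_-=0$, so $\mathcal H_k=\ker D_+$). Elements of $\mathcal H_k$ are called polarized sections. $\{\theta^{(k)}_j\}_{j=1}^{d_k}$ is any orthonormal basis of $\mathcal H_k$ ($\varepsilon^{(k)}$ does not depend on the choice). *)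

(* Defs.v *)
From HB Require Import structures.
From mathcomp Require Import all_boot all_order all_algebra perm.
From mathcomp Require Import all_classical all_reals all_analysis.
From mathcomp Require Import complex.

Set Implicit Arguments.
Unset Strict Implicit.
Unset Printing Implicit Defensive.

Import Order.TTheory GRing.Theory Num.Theory.
Import numFieldNormedType.Exports.

Local Open Scope classical_set_scope.
Local Open Scope ring_scope.
Local Open Scope complex_scope.

(* Tensors and sections are given by their         *)
(* components in charts.  Tangent vectors in a chart are row vectors and      *)
(* matrices act on the right: an endomorphism A sends v to v *m A, a bilinear *)
(* form B is (v, w) |-> v *m B *m w^T.                                        *)

Section Calculus.
Context {R : realType} {m : nat}.
Implicit Types (V : set 'rV[R]_m) (y : 'rV[R]_m).

Definition basis_vec (i : 'I_m) : 'rV[R]_m := delta_mx 0 i.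

Definition pd (i : 'I_m) (f : 'rV[R]_m -> R) y : R := 'D_(basis_vec i) f y.

Fixpoint Cn (p : nat) V (f : 'rV[R]_m -> R) : Prop :=
  (forall y, V y -> {for y, continuous f}) /\
  match p with
  | 0%N => True
  | p'.+1 => forall i : 'I_m,
      (forall y, V y -> derivable f y (basis_vec i)) /\ Cn p' V (pd i f)
  end.

Definition smooth V (f : 'rV[R]_m -> R) : Prop := forall p, Cn p V f.

Definition csmooth V (f : 'rV[R]_m -> R[i]) : Prop :=
  smooth V (fun y => complex.Re (f y)) /\ smooth V (fun y => complex.Im (f y)).

Definition cpd (i : 'I_m) (f : 'rV[R]_m -> R[i]) y : R[i] :=
  (pd i (fun z => complex.Re (f z)) y) +i* (pd i (fun z => complex.Im (f z)) y).

Definition mxpd {p q : nat} (i : 'I_m) (F : 'rV[R]_m -> 'M[R]_(p, q)) y :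
    'M[R]_(p, q) :=
  \matrix_(j, l) pd i (fun z => F z j l) y.

End Calculus.

(* The Lebesgue integral over R^m of a nonnegative Borel function, as an      *)
(* iterated integral (Tonelli).                                               *)
Fixpoint iint {R : realType} (m : nat) : ('rV[R]_m -> \bar R) -> \bar R :=
  match m with
  | 0%N => fun f => f 0
  | m'.+1 => fun f =>
      (\int[lebesgue_measure]_t
         iint (fun v : 'rV[R]_m' => f (row_mx (t%:M : 'rV[R]_1) v)))%E
  end.

Section ExteriorAlgebra.
Context {R : realType} {m : nat}.

(* The value at S = {i_1 < ... < i_q} is the coefficient of                   *)
(* dx_{i_1} /\ ... /\ dx_{i_q}.                                               *)
Definition extform := {ffun {set 'I_m} -> R[i]^o}.

Definition form1 : extform := [ffun S => (S == finset.set0)%:R].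

Definition shuffle_sign (A B : {set 'I_m}) : R[i] :=
  (-1) ^+ #|[set p : 'I_m * 'I_m | [&& p.1 \in A, p.2 \in B & (p.2 < p.1)%N]]%SET|.

Definition wedge (al be : extform) : extform :=
  [ffun S : {set 'I_m} =>
     \sum_(A : {set 'I_m} | A \subset S)
        shuffle_sign A (S :\: A) * al A * be (S :\: A)].

Definition wedge_pow (al : extform) (j : nat) : extform := iter j (wedge al) form1.

(* 1/2 \sum_(i, j) W i j dx_i /\ dx_j for an alternating W                    *)
Definition two_form (W : 'I_m -> 'I_m -> R[i]) : extform :=
  [ffun S : {set 'I_m} =>
     \sum_(i : 'I_m) \sum_(j : 'I_m | (i < j)%N && (S == [set i; j]%SET)) W i j].

Definition top_coef (al : extform) : R[i] := al [set: 'I_m]%SET.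

(* Matrices of forms. *)
Definition fmx := 'I_m -> 'I_m -> extform.

Definition fmx1 : fmx := fun p q => (p == q)%:R *: form1.

Definition fmx_mul (X Y : fmx) : fmx :=
  fun p q => \sum_r wedge (X p r) (Y r q).

Definition fmx_pow (X : fmx) (j : nat) : fmx := iter j (fmx_mul X) fmx1.

Definition fmx_det (X : fmx) : extform :=
  \sum_(s : 'S_m) ((-1) ^+ s : R[i]) *: \big[wedge/form1]_i X i (s i).

End ExteriorAlgebra.
Arguments extform : clear implicits.
Arguments fmx : clear implicits.

(* The first j coefficients of x / (1 - e^-x), computed from                  *)
(* (1 - e^-x) / x = \sum_i (-1)^i x^i / (i + 1)!.                             *)
Fixpoint todd_coefs {R : realType} (j : nat) : seq R :=
  if j is j'.+1 then
    let t := todd_coefs j' in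
    rcons t ((j' == 0%N)%:R -
             \sum_(i < j') t`_i * (-1) ^+ (j' - i) / ((j' - i).+1)`!%:R)
  else [::].

Definition todd_coef {R : realType} (j : nat) : R := (todd_coefs j.+1)`_j.

Section Spinors.
Context {R : realType} {m : nat}.
Implicit Types (v w : 'rV[R]_m) (vs : seq 'rV[R]_m).

(* A complex form of mixed degree on R^m: its value on a list of q vectors is *)
(* the value of its component of degree q.                                    *)
Definition spinor := seq 'rV[R]_m -> R[i]^o.

Implicit Types (al be : spinor) (g J : 'M[R]_m).

(* The forms of type (0, * ) for the complex structure J: restricted to real  *)
(* tangent vectors they are the alternating forms that are J-antilinear in    *)
(* each argument.                                                             *)
Definition form_0s J al : Prop :=
  [/\ forall us vs (c : R) v w,
        al (us ++ (c *: v + w) :: vs) =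
        c%:C * al (us ++ v :: vs) + al (us ++ w :: vs),
      forall us vs ws v, al (us ++ v :: vs ++ v :: ws) = 0
    & forall us vs v,
        al (us ++ (v *m J) :: vs) = - 'i * al (us ++ v :: vs)].

Definition interior_prod v al : spinor := fun vs => al (v :: vs).

Definition ext (th : 'rV[R]_m -> R[i]) al : spinor :=
  fun vs => \sum_(i < size vs)
    (-1) ^+ i * th (nth 0 vs i) * al (take i vs ++ drop i.+1 vs).

Definition bil (B : 'M[R]_m) v w : R := (v *m B *m w^T) 0 0.

(* The metric dual g(v^(1,0), .) of the (1,0)-part (v - i J v) / 2 of v. *)
Definition dual10 g J v : 'rV[R]_m -> R[i] :=
  fun w => 2^-1 * ((bil g v w)%:C - 'i * (bil g (v *m J) w)%:C).

(* c(v) = sqrt 2 (g(v^(1,0), .) /\ - contraction by v^(0,1)), for which       *)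
(* c(v)^2 = - g(v, v); on forms of type (0, * ) the contractions by v^(0,1)   *)
(* and by v agree.                                                            *)
Definition clifford g J v al : spinor :=
  fun vs => (Num.sqrt 2)%:C * (ext (dual10 g J v) al vs - interior_prod v al vs).

(* The Hermitian product induced on q-forms by the inverse metric h:          *)
(* 1/q! \sum h^{i_1 j_1} ... h^{i_q j_q} (al_{i_1...i_q})^* be_{j_1...j_q}    *)
Fixpoint form_herm (h : 'M[R]_m) (q : nat) al be : R[i] :=
  if q is q'.+1 then
    q%:R^-1 * \sum_i \sum_j (h i j)%:C *
      form_herm h q'
        (interior_prod (basis_vec i) al) (interior_prod (basis_vec j) be)
  else (al [::])^* * be [::].

End Spinors.
Arguments spinor : clear implicits.

Record atlas (R : realType) (m : nat) (M : topologicalType) := Atlas {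
  chart : Type;
  dom : chart -> set M;
  chart_map : chart -> M -> 'rV[R]_m;
  chart_inv : chart -> 'rV[R]_m -> M;
  chart_at : M -> chart;
  dom_open : forall a, open (dom a);
  chart_atP : forall x, dom (chart_at x) x;
  img_open : forall a, open (chart_map a @` dom a);
  coordK : forall a x, dom a x -> chart_inv a (chart_map a x) = x;
  coord_continuous : forall a x, dom a x -> {for x, continuous (chart_map a)};
  param_continuous : forall a y, (chart_map a @` dom a) y ->
    {for y, continuous (chart_inv a)};
  transition_smooth : forall a b j,
    smooth (chart_map a @` (dom a `&` dom b)) (fun y => chart_map b (chart_inv a y) 0 j)
}.
Arguments dom {R m M} X a : rename.
Arguments chart_map {R m M} X a : rename.
Arguments chart_inv {R m M} X a : rename.
Arguments chart_at {R m M} X x : rename.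

Definition img {R : realType} {m : nat} {M : topologicalType}
  (X : atlas R m M) (a : chart X) : set 'rV[R]_m := chart_map X a @` dom X a.

(* Jacobian matrix at x of the change of coordinates from a to b: the tangent *)
(* vector with components v in a has components v *m jac a b x in b.          *)
Definition jac {R : realType} {m : nat} {M : topologicalType}
    (X : atlas R m M) (a b : chart X) (x : M) : 'M[R]_m :=
  \matrix_(i, j) pd i (fun y => chart_map X b (chart_inv X a y) 0 j) (chart_map X a x).

Record almost_kahler (R : realType) (n : nat) (M : topologicalType)
    (X : atlas R (n + n) M) := AlmostKahler {
  omega : chart X -> 'rV[R]_(n + n) -> 'M[R]_(n + n);
  acs : chart X -> 'rV[R]_(n + n) -> 'M[R]_(n + n);
  omega_smooth : forall a i j, smooth (img a) (fun y => omega a y i j);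
  omega_tensor : forall a b x, dom X a x -> dom X b x ->
    omega a (chart_map X a x) =
    jac a b x *m omega b (chart_map X b x) *m (jac a b x)^T;
  omega_alt : forall a y, img a y -> (omega a y)^T = - omega a y;
  omega_nondeg : forall a y, img a y -> omega a y \in unitmx;
  omega_closed : forall a y i j l, img a y ->
    pd i (fun z => omega a z j l) y + pd j (fun z => omega a z l i) y +
    pd l (fun z => omega a z i j) y = 0;
  acs_smooth : forall a i j, smooth (img a) (fun y => acs a y i j);
  acs_tensor : forall a b x, dom X a x -> dom X b x ->
    acs a (chart_map X a x) *m jac a b x = jac a b x *m acs b (chart_map X b x);
  acs_sq : forall a y, img a y -> acs a y *m acs a y = - 1%:M;
  acs_symplectic : forall a y, img a y ->
    acs a y *m omega a y *m (acs a y)^T = omega a y;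
  acs_tame : forall a y v, img a y -> v != 0 ->
    0 < bil (omega a y) v (v *m acs a y)
}.
Arguments omega {R n M X} K a y : rename.
Arguments acs {R n M X} K a y : rename.

Section AlmostKahlerGeometry.
Context {R : realType} {n : nat} {M : topologicalType}.
Context {X : atlas R (n + n) M} (K : almost_kahler X).
Implicit Types (a : chart X) (y : 'rV[R]_(n + n)) (i j : 'I_(n + n)).

(* g = omega(., J .) *)
Definition metric a y : 'M[R]_(n + n) := omega K a y *m (acs K a y)^T.

Definition cometric a y : 'M[R]_(n + n) := invmx (metric a y).

(* J is integrable: around each point there are coordinates                   *)
(* (x_1, ..., x_n, y_1, ..., y_n) in which J d/dx_j = d/dy_j and              *)
(* J d/dy_j = - d/dx_j.                                                       *)
Definition integrable_acs : Prop :=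
  forall a y, img a y ->
  exists (W : set 'rV[R]_(n + n)) (z : 'I_(n + n) -> 'rV[R]_(n + n) -> R),
    [/\ open W, W y, W `<=` img a, forall j, smooth W (z j) &
        forall w, W w ->
          let D := \matrix_(i, j) pd i (z j) w in
          D \in unitmx /\
          acs K a w *m D = D *m block_mx 0 1%:M (- 1%:M) 0].

(* Levi-Civita connection: row j, column l of christoffel a i y is the        *)
(* coefficient of d/dx_l in the covariant derivative of d/dx_j along d/dx_i.  *)
Definition christoffel a i y : 'M[R]_(n + n) :=
  \matrix_(j, l) (2^-1 * \sum_p cometric a y l p *
    (pd i (fun z => metric a z j p) y + pd j (fun z => metric a z i p) y -
     pd p (fun z => metric a z i j) y)).

(* The connection 1/2 (nabla - J nabla J) on (TM, J), which is the projection *)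
(* to TM^(1,0) of the Levi-Civita connection nabla.                           *)
Definition christoffel10 a i y : 'M[R]_(n + n) :=
  2^-1 *: (christoffel a i y - mxpd i (acs K a) y *m acs K a y
           - acs K a y *m christoffel a i y *m acs K a y).

Definition curvature10 a i j y : 'M[R]_(n + n) :=
  mxpd i (christoffel10 a j) y - mxpd j (christoffel10 a i) y
  + christoffel10 a j y *m christoffel10 a i y
  - christoffel10 a i y *m christoffel10 a j y.

Definition proj10 a y : 'M[R[i]]_(n + n) :=
  2^-1 *: (1%:M - 'i *: map_mx (real_complex R) (acs K a y)).

(* det over TM^(1,0) of f(i R / 2 pi), where f(x) = x / (1 - e^-x) and R is   *)
(* the curvature of the connection above, computed on the complexified        *)
(* tangent space with the identity on TM^(0,1).  Powers > n of a matrix of    *)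
(* 2-forms vanish.                                                            *)
Definition todd_form a y : extform R (n + n) :=
  let F : fmx R (n + n) := fun p q =>
    two_form (fun i j => 'i * (curvature10 a i j y p q / (2 * pi))%:C) in
  fmx_det (fun p q =>
    \sum_(j < n.+1) (todd_coef j)%:C *:
      (\sum_r proj10 a y p r *: fmx_pow F j r q)
    + (1%:M - proj10 a y) p q *: form1).

(* exp of i / 2 pi times the curvature - i k omega *)
Definition ch_form (k : nat) a y : extform R (n + n) :=
  let F := two_form (fun i j => (k%:R * omega K a y i j / (2 * pi))%:C) in
  \sum_(j < n.+1) (j`!%:R^-1 : R[i]) *: wedge_pow F j.

(* The coefficient of omega^n / n! in the chart. *)
Definition volume_coef a y : R :=
  complex.Re (top_coef (wedge_pow (two_form
    (fun i j => (omega K a y i j)%:C)) n)) / n`!%:R.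

End AlmostKahlerGeometry.

Definition borel (M : ptopologicalType) := g_sigma_algebraType (@open M).

Section Integration.
Context {R : realType} {n : nat} {M : ptopologicalType}.
Context {X : atlas R (n + n) M} (K : almost_kahler X).
Variable mu : {measure set (borel M) -> \bar R}.

(* mu is the measure (2 pi)^-n omega^n / n!, M being oriented by omega^n. *)
Definition liouville : Prop :=
  forall (a : chart X) (B : set (borel M)), measurable B -> B `<=` dom X a ->
    mu B = iint (fun y => if `[< img a y /\ B (chart_inv X a y) >]
                          then (`|volume_coef K a y| / (2 * pi) ^+ n)%:E
                          else 0%E).

Definition cintegral (f : M -> R[i]) : R[i] :=
  (\int[mu]_(x in [set: borel M]) complex.Re (f x))%R +i*
  (\int[mu]_(x in [set: borel M]) complex.Im (f x))%R.

(* The integral over M of ch(l^k) Td(TM^(1,0)).  A top-degree form is         *)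
(* integrated by dividing it by (2 pi)^-n omega^n / n!.                       *)
Definition riemann_roch (k : nat) : R[i] :=
  cintegral (fun x =>
    let a := chart_at X x in let y := chart_map X a x in
    top_coef (wedge (ch_form K k a y) (todd_form K a y)) *
    ((2 * pi) ^+ n / volume_coef K a y)%:C).

End Integration.

(* A Hermitian line bundle with unitary frames e_a over the chart domains     *)
(* (every one is of this form for a fine enough atlas): s = s_a e_a with      *)
(* s_a = tran a b * s_b.  In the frame e_a the connection is d - i A_a with   *)
(* A_a real, that is, compatible with the Hermitian structure, and its        *)
(* curvature - i d A_a is - i omega.                                          *)
Record prequantum (R : realType) (n : nat) (M : topologicalType)
    (X : atlas R (n + n) M) (K : almost_kahler X) := Prequantum {
  tran : chart X -> chart X -> M -> R[i];
  conn : chart X -> 'rV[R]_(n + n) -> 'I_(n + n) -> R;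
  tran_smooth : forall a b,
    csmooth (chart_map X a @` (dom X a `&` dom X b))
            (fun y => tran a b (chart_inv X a y));
  tran_unitary : forall a b x, dom X a x -> dom X b x ->
    (tran a b x)^* * tran a b x = 1;
  tran_cocycle : forall a b c x, dom X a x -> dom X b x -> dom X c x ->
    tran a b x * tran b c x = tran a c x;
  conn_smooth : forall a i, smooth (img a) (fun y => conn a y i);
  conn_tran : forall a b x i, dom X a x -> dom X b x ->
    cpd i (fun y => tran a b (chart_inv X a y)) (chart_map X a x)
      - 'i * (conn a (chart_map X a x) i)%:C * tran a b x =
    - 'i * (\sum_j jac a b x i j * conn b (chart_map X b x) j)%:C * tran a b x;
  conn_curvature : forall a y i j, img a y ->
    pd i (fun z => conn a z j) y - pd j (fun z => conn a z i) y =
    omega K a y i j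
}.
Arguments tran {R n M X K} L a b x : rename.
Arguments conn {R n M X K} L a y i : rename.

(* A section is given by its components in all charts, extended by 0 outside  *)
(* of the image of the chart.                                                 *)
Definition sections (R : realType) (m : nat) (M : topologicalType)
    (X : atlas R m M) (F : Type) :=
  chart X -> 'rV[R]_m -> F.

Section Quantization.
Context {R : realType} {n : nat} {M : topologicalType}.
Context {X : atlas R (n + n) M} {K : almost_kahler X}.
Variables (L : prequantum K) (k : nat).
Implicit Types (a : chart X) (y : 'rV[R]_(n + n)) (i j : 'I_(n + n)).

Definition line_section (s : sections X R[i]^o) : Prop :=
  [/\ forall a y, ~ img a y -> s a y = 0,
      forall a, csmooth (img a) (s a)
    & forall a b x, dom X a x -> dom X b x ->
        s a (chart_map X a x) = tran L a b x ^+ k * s b (chart_map X b x)].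

Definition line_herm (s t : sections X R[i]^o) (x : M) : R[i] :=
  let a := chart_at X x in (s a (chart_map X a x))^* * t a (chart_map X a x).

Definition nabla a i (f : 'rV[R]_(n + n) -> R[i]) y : R[i] :=
  cpd i f y - 'i * (k%:R * conn L a y i)%:C * f y.

Definition holomorphic (s : sections X R[i]^o) : Prop :=
  line_section s /\
  forall a y (v : 'rV[R[i]]_(n + n)), img a y ->
    v *m map_mx (real_complex R) (acs K a y) = - 'i *: v ->
    \sum_i v 0 i * nabla a i (s a) y = 0.

(* Minus the trace of the second covariant derivative. *)
Definition laplacian a (f : 'rV[R]_(n + n) -> R[i]) y : R[i] :=
  - \sum_i \sum_j (cometric K a y i j)%:C *
      (nabla a i (nabla a j f) y
       - \sum_l (christoffel K a i y j l)%:C * nabla a l f y).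

Definition eigensection (lam : R) (s : sections X R[i]^o) : Prop :=
  line_section s /\
  forall a y, img a y ->
    laplacian a (s a) y - (n * k)%:R * s a y = lam%:C * s a y.

Definition spinor_section (s : sections X (spinor R (n + n))) : Prop :=
  [/\ forall a y, ~ img a y -> s a y = 0,
      forall a vs, csmooth (img a) (fun y => s a y vs),
      forall a b x vs, dom X a x -> dom X b x ->
        s a (chart_map X a x) vs =
        tran L a b x ^+ k * s b (chart_map X b x) [seq v *m jac a b x | v <- vs]
    & forall a y, img a y -> form_0s (acs K a y) (s a y)].

Definition spinor_herm (s t : sections X (spinor R (n + n))) (x : M) : R[i] :=
  let a := chart_at X x in let y := chart_map X a x in
  \sum_(q < (n + n).+1) form_herm (cometric K a y) q (s a y) (t a y).

Definition even_spinor (s : sections X (spinor R (n + n))) : Prop :=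
  forall a y vs, odd (size vs) -> s a y vs = 0.

Definition odd_spinor (s : sections X (spinor R (n + n))) : Prop :=
  forall a y vs, ~~ odd (size vs) -> s a y vs = 0.

Local Notation cl a y := (clifford (metric K a y) (acs K a y)).

(* The Clifford connection determined by the Levi-Civita connection and, on   *)
(* det TM^(1,0), by the connection induced by christoffel10: that connection  *)
(* on forms, tensored with nabla, plus the Clifford action                    *)
(* 1/4 \sum_(p, q) g(B e_p, e_q) c(e_p) c(e_q)  (e_p g-orthonormal)           *)
(* of the difference B of the two connections on TM.                          *)
Definition spin_nabla a i (f : 'rV[R]_(n + n) -> spinor R (n + n)) y :
    spinor R (n + n) :=
  let G := christoffel10 K a i y in
  let B := cometric K a y *m (christoffel K a i y - G) in
  fun vs =>
    nabla a i (fun z => f z vs) y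
    - \sum_(j < size vs) f y (set_nth 0 vs j (nth 0 vs j *m G))
    + 4^-1 * \sum_p \sum_q (B p q)%:C *
        cl a y (basis_vec p) (cl a y (basis_vec q) (f y)) vs.

Definition dirac a (f : 'rV[R]_(n + n) -> spinor R (n + n)) y :
    spinor R (n + n) :=
  fun vs => \sum_p \sum_q (cometric K a y p q)%:C *
    cl a y (basis_vec p) (spin_nabla a q f y) vs.

Definition dirac_kernel (s : sections X (spinor R (n + n))) : Prop :=
  spinor_section s /\ forall a y, img a y -> dirac a (s a) y = 0.

Definition ker_dirac_plus (s : sections X (spinor R (n + n))) : Prop :=
  dirac_kernel s /\ even_spinor s.

Definition ker_dirac_minus (s : sections X (spinor R (n + n))) : Prop :=
  dirac_kernel s /\ odd_spinor s.

End Quantization.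
Arguments spinor_herm {R n M X} K s t x.

Section L2.
Context {R : realType} {m : nat} {M : ptopologicalType} {X : atlas R m M}.
Context {F : lmodType R[i]}.
Variable mu : {measure set (borel M) -> \bar R}.
Variable herm : sections X F -> sections X F -> M -> R[i].
Implicit Types (s t : sections X F) (H : sections X F -> Prop).

Definition inner s t : R[i] := cintegral mu (herm s t).

Definition l2norm s : R := Num.sqrt (complex.Re (inner s s)).

(* |s(x)|^2 *)
Definition ptnorm2 s (x : M) : R := complex.Re (herm s s x).

Definition ptnorm s (x : M) : R := Num.sqrt (ptnorm2 s x).

Definition lincomb d (c : 'I_d -> R[i]) (theta : 'I_d -> sections X F) :
    sections X F :=
  fun a y => \sum_j c j *: theta j a y.

Definition lin_span d (theta : 'I_d -> sections X F) : sections X F -> Prop :=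
  fun s => exists c, s = lincomb c theta.

Definition orthonormal d (theta : 'I_d -> sections X F) : Prop :=
  forall i j, inner (theta i) (theta j) = (i == j)%:R.

Definition orthonormal_basis H d (theta : 'I_d -> sections X F) : Prop :=
  [/\ forall j, H (theta j), orthonormal theta
    & forall s, H s -> lin_span theta s].

Definition coherent_density d (theta : 'I_d -> sections X F) (x : M) : R :=
  \sum_j ptnorm2 (theta j) x.

End L2.

Section LowSpectrum.
Context {R : realType} {n : nat} {M : ptopologicalType}.
Context {X : atlas R (n + n) M} {K : almost_kahler X}.
Variable mu : {measure set (borel M) -> \bar R}.
Variables (L : prequantum K) (k d : nat).
Variables (psi : 'I_d -> sections X R[i]^o) (lam : 'I_d -> R).

(* mu0 is one of the remaining eigenvalues: it has an eigensection orthogonal *)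
(* to all the psi j.                                                          *)
Definition remaining_eigenvalue (mu0 : R) : Prop :=
  exists s : sections X R[i]^o,
    [/\ eigensection L k mu0 s, exists a y, s a y != 0
      & forall j, inner mu line_herm (psi j) s = 0].

(* The psi j are orthonormal eigensections for the first d eigenvalues lam j  *)
(* of Delta - n k, counted with multiplicity.                                 *)
Definition first_eigensections : Prop :=
  [/\ orthonormal mu line_herm psi,
      forall j, eigensection L k (lam j) (psi j),
      forall i j : 'I_d, (i <= j)%N -> lam i <= lam j
    & forall mu0, remaining_eigenvalue mu0 -> forall j, lam j <= mu0].

Definition spectral_gap (A C : R) : Prop :=
  (forall j, - A < lam j < A) /\
  (forall mu0, remaining_eigenvalue mu0 -> (n * k)%:R + C < mu0).

End LowSpectrum.

(* Main.v *)
Require Import Defs.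
From HB Require Import structures.
From mathcomp Require Import all_boot all_order all_algebra.
From mathcomp Require Import all_classical all_reals all_analysis.
From mathcomp Require Import complex.
From mathcomp Require Import measurable_realfun ring lra.

Set Implicit Arguments.
Unset Strict Implicit.
Unset Printing Implicit Defensive.

Import Order.TTheory GRing.Theory Num.Theory.
Import numFieldNormedType.Exports.

Local Open Scope classical_set_scope.
Local Open Scope ring_scope.

(** Write s = sum_j c_j theta_j.  The Cauchy-Schwarz inequality in the fibre at
    x gives
      |s(x)|^2 <= (sum_j |c_j|^2) (sum_j |theta_j(x)|^2),
    and orthonormality turns the first factor into ||s||^2.

    The fibrewise half is [psd_form_Cauchy_Schwarz], for any positive
    semidefinite Hermitian form.  The integrated half, [inner_lincomb], expands
    the integral of h(s, s) over the integrals of h(theta_i, theta_j), which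
    requires these functions to be integrable.  Orthonormality provides this:
    the integral of |theta_j|^2 is 1, whereas the real-valued integral of a
    nonnegative function with infinite integral is 0 by convention; the mixed
    terms are then dominated by |theta_i|^2 + |theta_j|^2.  What is left is
    measurability, and it follows from continuity of h(theta_i, theta_j) on M.
    All this is [coherent_density_bound], which is stated for an arbitrary
    field of positive semidefinite Hermitian forms on the fibres.

    It remains to see that the two Hermitian structures are such fields, and
    that they give continuous functions.  Both are computed at x in a chart
    chosen as a function of x, so continuity rests on independence of the chart:
    for the line bundle this is unitarity of the transition functions
    ([line_herm_continuous]); for the spinors one also needs invariance of the
    product of forms under the change of basis given by the Jacobian matrix
    ([spinor_form_chart]).  Positivity of the product of q-forms follows, degree
    by degree, from a factorization P^T P of the inverse metric
    ([form_herm_psd]).  In the almost Kahler case theta is itself a combination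
    of smooth eigensections, and continuity passes to combinations. *)

(** * Positive semidefinite Hermitian forms *)

Section PositiveForms.
Context {R : realType}.
Local Notation C := R[i].

Definition psd_form (V : lmodType C) (f : V -> V -> C) : Prop :=
  [/\ forall u a v w, f u (a *: v + w) = a * f u v + f u w,
      forall u v, f v u = ((f u v)^*)%C
    & forall u, 0 <= f u u].

Section Theory.
Context (V : lmodType C) (f : V -> V -> C) (f_psd : psd_form f).

Lemma psd_formDZr u a v w : f u (a *: v + w) = a * f u v + f u w.
Proof. by case: f_psd. Qed.

Lemma psd_formC u v : f v u = ((f u v)^*)%C.
Proof. by case: f_psd. Qed.

Lemma psd_form_ge0 u : 0 <= f u u.
Proof. by case: f_psd. Qed.

Lemma psd_form0r u : f u 0 = 0.
Proof.
have := psd_formDZr u 1 0 0; rewrite scale1r addr0 mul1r => /eqP.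
by rewrite -subr_eq0 opprD addNKr oppr_eq0 => /eqP.
Qed.

Lemma psd_formDr u v w : f u (v + w) = f u v + f u w.
Proof. by rewrite -{1}[v]scale1r psd_formDZr mul1r. Qed.

Lemma psd_formZr u a v : f u (a *: v) = a * f u v.
Proof. by rewrite -[a *: v]addr0 psd_formDZr psd_form0r addr0. Qed.

Lemma psd_formDl u v w : f (v + w) u = f v u + f w u.
Proof. by rewrite psd_formC psd_formDr rmorphD /= -!psd_formC. Qed.

Lemma psd_formZl u a v : f (a *: v) u = (a^*)%C * f v u.
Proof. by rewrite psd_formC psd_formZr rmorphM /= -psd_formC. Qed.

Lemma psd_form_sumr I (r : seq I) (P : pred I) u (v : I -> V) :
  f u (\sum_(i <- r | P i) v i) = \sum_(i <- r | P i) f u (v i).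
Proof. exact: (big_morph (f u) (psd_formDr u) (psd_form0r u)). Qed.

Lemma psd_form_suml I (r : seq I) (P : pred I) u (v : I -> V) :
  f (\sum_(i <- r | P i) v i) u = \sum_(i <- r | P i) f (v i) u.
Proof.
by rewrite psd_formC psd_form_sumr rmorph_sum /=; under eq_bigr do rewrite -psd_formC.
Qed.

Lemma psd_form_lincomb d (a b : 'I_d -> C) (u v : 'I_d -> V) :
  f (\sum_i a i *: u i) (\sum_j b j *: v j) =
  \sum_i \sum_j (a i)^*%C * b j * f (u i) (v j).
Proof.
rewrite psd_form_suml; apply: eq_bigr => i _; rewrite psd_form_sumr.
by apply: eq_bigr => j _; rewrite psd_formZl psd_formZr mulrA.
Qed.

(** Positivity at u + a v; taking a among the fourth roots of unity bounds the
    real and imaginary parts of f u v. *)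
Lemma psd_form_ge0_addZ u v (a : C) : (a^*)%C * a = 1 ->
  0 <= f u u + f v v + (a * f u v + (a * f u v)^*%C).
Proof.
move=> a1; have := psd_form_ge0 (u + a *: v).
rewrite psd_formDl !psd_formDr psd_formZl psd_formZl !psd_formZr mulrA a1 mul1r.
rewrite rmorphM /= -psd_formC; congr (0 <= _); ring.
Qed.

(** Lagrange's identity: twice the difference of the two sides is the sum over
    i, j of the values of f on the diagonal at conj(a_j) u_i - conj(a_i) u_j. *)
Lemma psd_form_Cauchy_Schwarz d (a : 'I_d -> C) (u : 'I_d -> V) :
  f (\sum_i a i *: u i) (\sum_i a i *: u i) <=
  (\sum_i (a i)^*%C * a i) * \sum_i f (u i) (u i).
Proof.
have: 0 <= \sum_i \sum_j
    f ((a j)^*%C *: u i - (a i)^*%C *: u j) ((a j)^*%C *: u i - (a i)^*%C *: u j).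
  by apply: sumr_ge0 => i _; apply: sumr_ge0 => j _; exact: psd_form_ge0.
set S := \sum_i \sum_j _; rewrite psd_form_lincomb.
set T := \sum_i \sum_j _; set P := _ * _.
suff -> : S = (P - T) *+ 2 by rewrite pmulrn_lge0 // subr_ge0.
(* Expanding S gives four double sums; PE and PE' present P, and the definition
   of T and TE' present T, in the two index orders in which they occur. *)
have PE : P = \sum_i \sum_j ((a j)^*%C * a j) * f (u i) (u i).
  rewrite /P mulrC mulr_suml; apply: eq_bigr => i _.
  by rewrite mulr_sumr; apply: eq_bigr => j _; rewrite mulrC.
have PE' : P = \sum_i \sum_j ((a i)^*%C * a i) * f (u j) (u j).
  by rewrite PE exchange_big.
have TE' : T = \sum_i \sum_j ((a j)^*%C * a i * f (u j) (u i)).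
  by rewrite /T exchange_big.
rewrite mulr2n {1}PE PE' {1}/T TE' -!sumrB -big_split; apply: eq_bigr => i _ /=.
rewrite -!sumrB -big_split; apply: eq_bigr => j _ /=.
rewrite -[- (_ *: u j)]scaleNr psd_formDl !psd_formDr !psd_formZl !psd_formZr.
rewrite !rmorphN /= !conjcK.
ring.
Qed.

End Theory.
End PositiveForms.

(** The domination that makes mixed terms integrable as soon as the diagonal
    ones are. *)
Lemma psd_form_cross_bound (R : realType) (V : lmodType R[i])
    (f : V -> V -> R[i]) (f_psd : psd_form f) u v :
  `|complex.Re (f u v)| <= complex.Re (f u u) + complex.Re (f v v) /\
  `|complex.Im (f u v)| <= complex.Re (f u u) + complex.Re (f v v).
Proof.
have unit a : (a^*)%C * a = 1 :> R[i] ->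
    0 <= complex.Re (f u u) + complex.Re (f v v) + 2 * complex.Re (a * f u v).
  move=> /(psd_form_ge0_addZ f_psd u v); rewrite lecE => /andP[_] /=.
  case: (f u u) (f v v) (a * f u v) => [? ?] [? ?] [? ?] /=; lra.
have /unit : ((1 : R[i])^*)%C * 1 = 1 by rewrite rmorph1 mulr1.
have /unit : ((- 1 : R[i])^*)%C * - 1 = 1 by rewrite rmorphN1 mulrNN mulr1.
have ii : (('i%C : R[i])^*)%C * 'i%C = 1.
  by apply/eqP; rewrite eq_complex /=; apply/andP; split; apply/eqP; ring.
have /unit := ii.
have /unit : ((- 'i%C : R[i])^*)%C * - 'i%C = 1 by rewrite rmorphN mulrNN ii.
case: (f u u) (f v v) (f u v) => [? ?] [? ?] [? ?] /= *.
split; rewrite ler_norml; apply/andP; split; lra.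
Qed.

Lemma psd_form_sum (R : realType) (V : lmodType R[i]) (I : Type) (r : seq I)
    (f : I -> V -> V -> R[i]) :
  (forall i, psd_form (f i)) -> psd_form (fun u v => \sum_(i <- r) f i u v).
Proof.
move=> f_psd; split=> [u a v w|u v|u].
- rewrite mulr_sumr -big_split; apply: eq_bigr => i _.
  exact: (psd_formDZr (f_psd i)).
- by rewrite rmorph_sum; apply: eq_bigr => i _; exact: (psd_formC (f_psd i)).
- by apply: sumr_ge0 => i _; exact: (psd_form_ge0 (f_psd i)).
Qed.

Lemma psd_form_conj_mul (R : realType) :
  psd_form (fun u v : R[i]^o => (u^*)%C * v : R[i]).
Proof.
split=> [u a v w|u v|u].
- by rewrite mulrDr -[a *: v]/(a * v) mulrCA.
- by rewrite rmorphM /= conjcK mulrC.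
- by rewrite mulrC -normCK exprn_ge0.
Qed.

(** * Continuity of complex-valued functions *)

Section ContinuousAt.
Context {R : realType} {T : topologicalType}.
Implicit Types (f g : T -> R[i]) (x : T).

Definition ccontinuous_at f x : Prop :=
  {for x, continuous (fun z => complex.Re (f z))} /\
  {for x, continuous (fun z => complex.Im (f z))}.

Lemma ccontinuous_cst c x : ccontinuous_at (fun=> c) x.
Proof. by split; exact: cst_continuous. Qed.

Lemma ccontinuous_real (r : T -> R) x :
  {for x, continuous r} -> ccontinuous_at (fun z => (r z)%:C%C) x.
Proof. by move=> rx; split => //=; exact: cst_continuous. Qed.

Lemma ccontinuousD f g x : ccontinuous_at f x -> ccontinuous_at g x ->
  ccontinuous_at (fun z => f z + g z) x.
Proof.
move=> [fr fi] [gr gi]; split.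
- rewrite (_ : (fun _ => _) =
      (fun z => complex.Re (f z)) \+ (fun z => complex.Re (g z))).
    exact: continuousD.
  by apply/funext => z /=; rewrite raddfD.
- rewrite (_ : (fun _ => _) =
      (fun z => complex.Im (f z)) \+ (fun z => complex.Im (g z))).
    exact: continuousD.
  by apply/funext => z /=; rewrite raddfD.
Qed.

Lemma ccontinuousM f g x : ccontinuous_at f x -> ccontinuous_at g x ->
  ccontinuous_at (fun z => f z * g z) x.
Proof.
move=> [fr fi] [gr gi]; split.
- rewrite (_ : (fun _ => _) = (fun z => complex.Re (f z) * complex.Re (g z)
      - complex.Im (f z) * complex.Im (g z))).
    by apply: continuousB; exact: continuousM.
  by apply/funext => z /=; case: (f z) (g z) => [? ?] [? ?].
- rewrite (_ : (fun _ => _) = (fun z => complex.Re (f z) * complex.Im (g z)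
      + complex.Im (f z) * complex.Re (g z))).
    by apply: continuousD; exact: continuousM.
  by apply/funext => z /=; case: (f z) (g z) => [? ?] [? ?].
Qed.

Lemma ccontinuous_conj f x : ccontinuous_at f x ->
  ccontinuous_at (fun z => (f z)^*%C) x.
Proof.
move=> [fr fi]; split.
- rewrite (_ : (fun _ => _) = fun z => complex.Re (f z)) //.
  by apply/funext => z; case: (f z).
- rewrite (_ : (fun _ => _) = fun z => - complex.Im (f z)); first exact: continuousN.
  by apply/funext => z; case: (f z).
Qed.

Lemma ccontinuous_sum I (r : seq I) (P : pred I) (F : I -> T -> R[i]) x :
  (forall i, P i -> ccontinuous_at (F i) x) ->
  ccontinuous_at (fun z => \sum_(i <- r | P i) F i z) x.
Proof.
move=> Fx; elim: r => [|i r IHr].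
  rewrite (_ : (fun _ => _) = fun=> 0); first exact: ccontinuous_cst.
  by apply/funext => z; rewrite big_nil.
rewrite (_ : (fun _ => _) = fun z =>
   (if P i then F i z else 0) + \sum_(j <- r | P j) F j z); last first.
  by apply/funext => z; rewrite big_cons; case: ifP => // _; rewrite add0r.
apply: ccontinuousD => //; case: (boolP (P i)) => [|_]; first exact: Fx.
exact: ccontinuous_cst.
Qed.

Lemma ccontinuous_near f g x :
  (\forall z \near x, f z = g z) -> ccontinuous_at f x -> ccontinuous_at g x.
Proof.
move=> fg [fr fi]; have fgx : f x = g x by exact: nbhs_singleton fg.
have near_cvg (h : R[i] -> R) : {for x, continuous (fun z => h (f z))} ->
    {for x, continuous (fun z => h (g z))}.
  move=> hf; rewrite /prop_for /continuous_at -fgx; apply: cvg_trans hf.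
  by apply: near_eq_cvg; apply: filterS fg => z ->.
by split; exact: near_cvg.
Qed.

End ContinuousAt.

Lemma ccontinuous_comp (R : realType) (S T : topologicalType) (h : S -> T)
    (f : T -> R[i]) (w : S) :
  {for w, continuous h} -> ccontinuous_at f (h w) ->
  ccontinuous_at (fun z => f (h z)) w.
Proof.
move=> hw [fr fi].
by split; [exact: continuous_comp hw fr | exact: continuous_comp hw fi].
Qed.

(** * Integration of complex-valued functions *)

Section ComplexIntegral.
Context {R : realType} {M : ptopologicalType}.
Variable mu : {measure set (borel M) -> \bar R}.
Implicit Types f g : M -> R[i].

Definition cintegrable f : Prop :=
  mu.-integrable [set: borel M] (fun x => (complex.Re (f x))%:E) /\
  mu.-integrable [set: borel M] (fun x => (complex.Im (f x))%:E).

Lemma cintegrable0 : cintegrable (fun=> 0).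
Proof. by split; exact: integrable0. Qed.

Lemma cintegrableD f g : cintegrable f -> cintegrable g ->
  cintegrable (fun x => f x + g x).
Proof.
move=> [fr fi] [gr gi]; split.
- apply: eq_integrable (integrableD _ fr gr) => // x _.
  by rewrite raddfD EFinD.
- apply: eq_integrable (integrableD _ fi gi) => // x _.
  by rewrite raddfD EFinD.
Qed.

Lemma cintegralD f g : cintegrable f -> cintegrable g ->
  cintegral mu (fun x => f x + g x) = cintegral mu f + cintegral mu g.
Proof.
move=> [fr fi] [gr gi]; apply/eqP; rewrite eq_complex /= -!RintegralD //.
by apply/andP; split; apply/eqP; apply: eq_Rintegral => x _; rewrite raddfD.
Qed.

Lemma cintegrableZ a f : cintegrable f -> cintegrable (fun x => a * f x).
Proof.
move=> [fr fi]; split.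
- apply: eq_integrable (integrableB _ (integrableZl _ (complex.Re a) fr)
    (integrableZl _ (complex.Im a) fi)) => // x _.
  by case: a (f x) => [? ?] [? ?] /=; rewrite EFinB !EFinM.
- apply: eq_integrable (integrableD _ (integrableZl _ (complex.Re a) fi)
    (integrableZl _ (complex.Im a) fr)) => // x _.
  by case: a (f x) => [? ?] [? ?] /=; rewrite EFinD !EFinM.
Qed.

Lemma cintegralZ a f : cintegrable f ->
  cintegral mu (fun x => a * f x) = a * cintegral mu f.
Proof.
move=> [fr fi]; have ri (r : R) (g : M -> R) :
    mu.-integrable [set: borel M] (fun x => (g x)%:E) ->
    mu.-integrable [set: borel M] (fun x => (r * g x)%:E).
  by move=> gint; apply: eq_integrable (integrableZl _ r gint) => // x _; rewrite EFinM.
apply/eqP; rewrite eq_complex.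
case: a => [b c] /=; rewrite -!RintegralZl // -RintegralB // -?RintegralD //;
  try exact: ri.
by apply/andP; split; apply/eqP; apply: eq_Rintegral => x _; case: (f x).
Qed.

Lemma cintegrable_sum I (r : seq I) (F : I -> M -> R[i]) :
  (forall i, cintegrable (F i)) -> cintegrable (fun x => \sum_(i <- r) F i x).
Proof.
move=> Fint; elim: r => [|i r IHr].
  rewrite (_ : (fun _ => _) = fun=> 0); first exact: cintegrable0.
  by apply/funext => x; rewrite big_nil.
rewrite (_ : (fun _ => _) = fun x => F i x + \sum_(j <- r) F j x).
  exact: cintegrableD.
by apply/funext => x; rewrite big_cons.
Qed.

Lemma cintegral_sum I (r : seq I) (F : I -> M -> R[i]) :
  (forall i, cintegrable (F i)) ->
  cintegral mu (fun x => \sum_(i <- r) F i x) = \sum_(i <- r) cintegral mu (F i).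
Proof.
move=> Fint; elim: r => [|i r IHr].
  rewrite big_nil -[RHS](mul0r (cintegral mu (fun=> 0))) -cintegralZ;
    last exact: cintegrable0.
  by congr cintegral; apply/funext => x; rewrite big_nil mul0r.
rewrite big_cons -IHr -cintegralD //; last exact: cintegrable_sum.
by congr cintegral; apply/funext => x; rewrite big_cons.
Qed.

Lemma continuous_measurable_borel (f : M -> R) :
  continuous f -> measurable_fun [set: borel M] f.
Proof.
move=> /continuousP cf; apply: (measurability _ (RGenOpens.measurableE R)).
move=> _ [_ [a [b ->] <-]]; rewrite setTI; apply: sub_sigma_algebra.
exact/cf/interval_open.
Qed.

End ComplexIntegral.

(** * The coherent density bound for a field of Hermitian forms *)

Section CoherentBound.
Context {R : realType} {m : nat} {M : ptopologicalType} {X : atlas R m M}.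
Context {F : lmodType R[i]}.
Variable mu : {measure set (borel M) -> \bar R}.
Variables (B : M -> F -> F -> R[i]) (B_psd : forall x, psd_form (B x)).

(** The common shape of the Hermitian structures on sections: a field of forms
    on the fibre F, evaluated on components in the chart chosen at x.  Both
    [line_herm] and [spinor_herm] are convertible to an instance. *)
Definition herm_of (s t : sections X F) (x : M) : R[i] :=
  let a := chart_at X x in let y := chart_map X a x in B x (s a y) (t a y).

Lemma herm_of_lincomb d (a b : 'I_d -> R[i]) (u v : 'I_d -> sections X F) x :
  herm_of (lincomb a u) (lincomb b v) x =
  \sum_i \sum_j (a i)^*%C * b j * herm_of (u i) (v j) x.
Proof. exact: psd_form_lincomb. Qed.

(** A nonnegative function with infinite integral has real-valued integral
    fine(+oo) = 0, so an integral equal to 1 is a genuine finite integral. *)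
Lemma unit_norm_integrable (s : sections X F) :
  (forall x, ccontinuous_at (herm_of s s) x) -> inner mu herm_of s s = 1 ->
  mu.-integrable [set: borel M] (fun x => (complex.Re (herm_of s s x))%:E).
Proof.
move=> s_cont s1; apply/integrableP; split.
  apply/measurable_EFinP; apply: continuous_measurable_borel => x.
  by case: (s_cont x).
have -> : (fun x => `|(complex.Re (herm_of s s x))%:E|%E)
    = fun x => (complex.Re (herm_of s s x))%:E.
  apply/funext => x; rewrite gee0_abs // lee_fin.
  by have := psd_form_ge0 (B_psd x) (s (chart_at X x) (chart_map X (chart_at X x) x));
    rewrite lecE => /andP[].
move: s1 => /(congr1 (@complex.Re R)) /=; rewrite /Rintegral ltey.
by apply: contra_eqN => /eqP -> /=; rewrite eq_sym oner_eq0.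
Qed.

Lemma orthonormal_cintegrable d (theta : 'I_d -> sections X F) :
  (forall i j x, ccontinuous_at (herm_of (theta i) (theta j)) x) ->
  Defs.orthonormal mu herm_of theta ->
  forall i j, cintegrable mu (herm_of (theta i) (theta j)).
Proof.
move=> theta_cont theta_on i j.
have int l : mu.-integrable [set: borel M]
    (fun x => (complex.Re (herm_of (theta l) (theta l) x))%:E).
  by apply: unit_norm_integrable => //; rewrite theta_on eqxx.
have le_int (g : M -> R) : continuous g ->
    (forall x, `|g x| <= complex.Re (herm_of (theta i) (theta i) x) +
                         complex.Re (herm_of (theta j) (theta j) x)) ->
    mu.-integrable [set: borel M] (fun x => (g x)%:E).
  move=> g_cont g_le; apply: le_integrable (integrableD _ (int i) (int j)) => //.
    by apply/measurable_EFinP; exact: continuous_measurable_borel.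
  by move=> x _ /=; rewrite lee_fin (le_trans (g_le x)) // ler_norm.
split; apply: le_int => x.
- by case: (theta_cont i j x).
- exact: (psd_form_cross_bound (B_psd x) _ _).1.
- by case: (theta_cont i j x).
- exact: (psd_form_cross_bound (B_psd x) _ _).2.
Qed.

Lemma inner_lincomb d (theta : 'I_d -> sections X F) (c : 'I_d -> R[i]) :
  (forall i j x, ccontinuous_at (herm_of (theta i) (theta j)) x) ->
  Defs.orthonormal mu herm_of theta ->
  inner mu herm_of (lincomb c theta) (lincomb c theta) = \sum_i (c i)^*%C * c i.
Proof.
move=> theta_cont theta_on.
have int := orthonormal_cintegrable theta_cont theta_on.
rewrite /inner (funext (herm_of_lincomb c c theta theta)).
rewrite cintegral_sum => [|i]; last first.
  by apply: cintegrable_sum => j; exact: cintegrableZ.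
apply: eq_bigr => i _; rewrite cintegral_sum => [|j]; last exact: cintegrableZ.
rewrite (bigD1 i) //= big1 => [|j ji];
  rewrite cintegralZ // -/(inner mu herm_of _ _) theta_on.
  by rewrite eqxx mulr1 addr0.
by rewrite eq_sym (negPf ji) mulr0.
Qed.

(** Cauchy-Schwarz in the fibre at x against the coefficients of s, whose sum of
    squared moduli is the squared norm of s by [inner_lincomb]. *)
Lemma coherent_density_bound d (theta : 'I_d -> sections X F) :
  (forall i j x, ccontinuous_at (herm_of (theta i) (theta j)) x) ->
  Defs.orthonormal mu herm_of theta ->
  forall s, lin_span theta s ->
  forall x, ptnorm herm_of s x <=
    l2norm mu herm_of s * Num.sqrt (coherent_density herm_of theta x).
Proof.
move=> theta_cont theta_on _ [c ->] x.
rewrite /ptnorm /l2norm inner_lincomb //.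
have sq_ge0 : 0 <= \sum_i (c i)^*%C * c i.
  by apply: sumr_ge0 => i _; rewrite mulrC -normCK exprn_ge0.
have := sq_ge0; rewrite lecE => /andP[/eqP sq_im sq_re].
rewrite -sqrtrM // ler_wsqrtr //.
have := psd_form_Cauchy_Schwarz (B_psd x) c
  (fun j => theta j (chart_at X x) (chart_map X (chart_at X x) x)).
rewrite -/(lincomb c theta _ _) -/(herm_of (lincomb c theta) (lincomb c theta) x).
have Re_realM (z w : R[i]) : complex.Im z = 0 ->
    complex.Re (z * w) = complex.Re z * complex.Re w.
  by case: z w => [p q] [u v] /= ->; rewrite mul0r subr0.
rewrite lecE => /andP[_]; rewrite Re_realM //.
by rewrite [X in _ <= _ * X -> _]raddf_sum.
Qed.

End CoherentBound.

(** Passes continuity from a family of smooth sections to its span without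
    differentiating combinations of sections. *)
Lemma ccontinuous_lincomb (R : realType) (m : nat) (M : ptopologicalType)
    (X : atlas R m M) (F : lmodType R[i]) (B : M -> F -> F -> R[i]) d
    (psi : 'I_d -> sections X F) s t :
  (forall x, psd_form (B x)) ->
  (forall i j x, ccontinuous_at (herm_of B (psi i) (psi j)) x) ->
  lin_span psi s -> lin_span psi t ->
  forall x, ccontinuous_at (herm_of B s t) x.
Proof.
move=> B_psd psi_cont [c ->] [e ->] x.
rewrite (funext (herm_of_lincomb B_psd c e psi psi)).
apply: ccontinuous_sum => i _; apply: ccontinuous_sum => j _.
by apply: ccontinuousM => //; exact: ccontinuous_cst.
Qed.

(** * Positive definite matrices and continuity of the inverse *)

Section PositiveMatrices.
Context {R : realType}.

Definition posdef m (h : 'M[R]_m) : Prop :=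
  h^T = h /\ forall v : 'rV[R]_m, v != 0 -> 0 < bil h v v.

Lemma bil_block m1 m2 (a : 'M[R]_m1) b c (e : 'M[R]_m2) v w v' w' :
  bil (block_mx a b c e) (row_mx v w) (row_mx v' w') =
  bil a v v' + (v *m b *m w'^T) 0 0 + (w *m c *m v'^T) 0 0 + bil e w w'.
Proof.
by rewrite /bil tr_row_mx mul_row_block mul_row_col !mulmxDl !mxE; ring.
Qed.

(** Induction on the size by splitting off the first row and column: if r is the
    corner entry and b the rest of the first row, the Schur complement
    e - b^T b / r of the remaining block e is positive definite too. *)
Lemma posdef_Cholesky m (h : 'M[R]_m) : posdef h -> exists P : 'M[R]_m, h = P^T *m P.
Proof.
elim: m h => [|m IHm] h [h_sym h_gt0].
  by exists 0; rewrite flatmx0 [RHS]flatmx0.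
move: h h_sym h_gt0; rewrite -[m.+1]/(1 + m)%N => h.
rewrite -[h]submxK; set a := ulsubmx h; set b := ursubmx h.
set c := dlsubmx h; set e := drsubmx h.
rewrite tr_block_mx => /eq_block_mx[_ _ bc e_sym] h_gt0.
rewrite -bc in h_gt0 *; pose r := a 0 0.
have aE : a = r%:M by exact: mx11_scalar.
have r_gt0 : 0 < r.
  have /h_gt0 : row_mx (1%:M : 'M[R]_1) (0 : 'rV_m) != 0.
    by rewrite row_mx_eq0 eqxx andbT matrix_nonzero1.
  by rewrite bil_block /bil !mul0mx trmx0 !mulmx0 mul1mx trmx1 mulmx1 /r !mxE !addr0.
have r_neq0 : r != 0 by rewrite gt_eqF.
have [|Q QE] := IHm (e - r^-1 *: (b^T *m b)).
  split=> [|w w_neq0].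
    by rewrite raddfB /= e_sym linearZ /= trmx_mul trmxK.
  (* The value of t minimizing the quadratic form h at (t, w); the minimum is
     the value at w of the Schur complement. *)
  pose t := - r^-1 * (w *m b^T) 0 0.
  have /h_gt0 : row_mx (t%:M : 'M[R]_1) w != 0.
    by rewrite row_mx_eq0 negb_and w_neq0 orbT.
  rewrite bil_block aE /bil !mul_scalar_mx tr_scalar_mx !mul_mx_scalar.
  have bw : (b *m w^T) 0 0 = (w *m b^T) 0 0.
    by rewrite -[b *m w^T]trmxK trmx_mul trmxK [LHS]mxE.
  have -> : w *m (e - r^-1 *: (b^T *m b)) *m w^T =
      w *m e *m w^T - r^-1 *: (w *m b^T *m (b *m w^T)).
    by rewrite mulmxBr mulmxBl -scalemxAr -scalemxAl !mulmxA.
  rewrite -!scalemxAl; move: bw; rewrite /t.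
  case: (w *m e *m w^T) (b *m w^T) (w *m b^T) => E bw wb bwE.
  rewrite !mxE !big_ord1 /= bwE mulr1n; congr (0 < _); field.
  by rewrite r_neq0.
exists (block_mx (Num.sqrt r)%:M ((Num.sqrt r)^-1 *: b) 0 Q).
rewrite tr_block_mx mulmx_block tr_scalar_mx trmx0 !mul0mx !mulmx0 !addr0.
rewrite -scalar_mxM -expr2 sqr_sqrtr ?ltW // -aE.
have s_neq0 : Num.sqrt r != 0 by rewrite gt_eqF // sqrtr_gt0.
rewrite mul_scalar_mx mul_mx_scalar [(_ *: b)^T]linearZ /= !scalerA
  mulfV // ?mulVf // !scale1r.
rewrite -scalemxAl -scalemxAr scalerA -expr2 exprVn sqr_sqrtr ?ltW //.
by rewrite -QE addrC subrK.
Qed.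

End PositiveMatrices.

Lemma posdef_invmx (R : realType) m (h : 'M[R]_m) :
  h \in unitmx -> posdef h -> posdef (invmx h).
Proof.
move=> h_unit [h_sym h_gt0]; split=> [|v v_neq0]; first by rewrite trmx_inv h_sym.
have v'_neq0 : v *m invmx h != 0.
  by apply: contra_neq v_neq0 => vh; rewrite -[v](mulmxKV h_unit) vh mul0mx.
have := h_gt0 _ v'_neq0.
by rewrite /bil (mulmxKV h_unit) trmx_mul trmx_inv h_sym mulmxA.
Qed.

(** J is invertible because J g' J^T is.  For J a Jacobian matrix this spares
    differentiating the inverse change of coordinates. *)
Lemma invmx_congruence (R : realType) m (g g' J : 'M[R]_m) :
  g = J *m g' *m J^T -> g \in unitmx -> invmx g' = J^T *m invmx g *m J.
Proof.
move=> gE g_unit.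
have /andP[J_unit g'_unit] : (J \in unitmx) && (g' \in unitmx).
  by move: g_unit; rewrite gE !unitmx_mul => /andP[].
suff g'Z : g' *m (J^T *m invmx g *m J) = 1%:M.
  by rewrite -[RHS](mulKmx g'_unit) g'Z mulmx1.
apply: (can_inj (mulKmx J_unit)).
by rewrite !mulmxA -gE mulmxV // mul1mx mulmx1.
Qed.

Lemma continuous_mulmx (R : realType) (T : topologicalType) m p q
    (A : T -> 'M[R]_(m, p)) (B : T -> 'M[R]_(p, q)) x :
  (forall i j, {for x, continuous (fun z => A z i j)}) ->
  (forall i j, {for x, continuous (fun z => B z i j)}) ->
  forall i j, {for x, continuous (fun z => (A z *m B z) i j)}.
Proof.
move=> A_cont B_cont i j.
rewrite (_ : (fun z => _) = fun z => \sum_r A z i r * B z r j).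
  rewrite /prop_for /continuous_at.
  apply: cvg_big => [|r _]; first exact: add_continuous.
  by apply: cvgM; [exact: A_cont | exact: B_cont].
by apply/funext => z; rewrite mxE.
Qed.

Lemma continuous_det (R : realType) m (T : topologicalType)
    (A : T -> 'M[R]_m) x :
  (forall i j, {for x, continuous (fun z => A z i j)}) ->
  {for x, continuous (fun z => \det (A z))}.
Proof.
move=> A_cont; rewrite /determinant /prop_for /continuous_at.
apply: cvg_big => [|s _]; first exact: add_continuous.
apply: cvgM; first exact: cvg_cst.
by apply: cvg_big => [|i _]; [exact: mul_continuous | exact: A_cont].
Qed.

(** Cramer's rule, valid near x because invertibility is. *)
Lemma continuous_invmx (R : realType) m (T : topologicalType)
    (A : T -> 'M[R]_m) x :
  (\forall z \near x, A z \in unitmx) ->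
  (forall i j, {for x, continuous (fun z => A z i j)}) ->
  forall i j, {for x, continuous (fun z => invmx (A z) i j)}.
Proof.
move=> A_unit A_cont i j.
have Ax : A x \in unitmx by exact: nbhs_singleton A_unit.
pose f z := (\det (A z))^-1 * cofactor (A z) j i.
have f_cont : {for x, continuous f}.
  apply: continuousM.
    apply: continuousV; last exact: continuous_det.
    by rewrite -unitfE -unitmxE.
  apply: continuousM; first exact: cst_continuous.
  apply: continuous_det => p q.
  rewrite (_ : (fun z => _) = fun z => A z (lift j p) (lift i q)) //.
  by apply/funext => z; rewrite !mxE.
have fE z : A z \in unitmx -> f z = invmx (A z) i j.
  by move=> Az; rewrite /invmx Az !mxE.
rewrite /prop_for /continuous_at -fE //; apply: cvg_trans f_cont.
by apply: near_eq_cvg; apply: filterS A_unit => z /fE.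
Qed.

(** * The Hermitian product on forms *)

Section FormHerm.
Context {R : realType} {m : nat}.
Implicit Types (h J : 'M[R]_m) (al be : spinor R m).

Lemma interior_prodDZ v (a : R[i]) al be :
  interior_prod v (a *: al + be) = a *: interior_prod v al + interior_prod v be.
Proof. by []. Qed.

Lemma form_hermDZr h q al (a : R[i]) be ga :
  form_herm h q al (a *: be + ga) = a * form_herm h q al be + form_herm h q al ga.
Proof.
elim: q al be ga => [|q IHq] al be ga /=.
  by rewrite -[(a *: be + ga) [::]]/(a * be [::] + ga [::]) mulrDr mulrCA.
rewrite mulrCA -mulrDr; congr (_ * _).
rewrite mulr_sumr -big_split; apply: eq_bigr => i _ /=.
rewrite mulr_sumr -big_split; apply: eq_bigr => j _ /=.
by rewrite interior_prodDZ IHq mulrDr mulrCA.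
Qed.

Lemma form_hermC h q al be : h^T = h ->
  form_herm h q be al = (form_herm h q al be)^*%C.
Proof.
move=> h_sym; elim: q al be => [|q IHq] al be /=.
  by rewrite rmorphM /= conjcK mulrC.
rewrite rmorphM /= fmorphV rmorph_nat rmorph_sum exchange_big /=; congr (_ * _).
apply: eq_bigr => i _; rewrite rmorph_sum; apply: eq_bigr => j _.
rewrite rmorphM IHq -{1}h_sym mxE; congr (_ * _).
exact/esym/conjc_real.
Qed.

(** Write h = P^T P.  Then the product of two (q+1)-forms is, up to the factor
    1/(q+1), the sum over k of the products of the q-forms obtained by
    contraction with the k-th row of P, and positivity passes from q to q+1. *)
Lemma form_herm_psd h q : posdef h -> psd_form (form_herm h q).
Proof.
move=> h_pos; have [P hE] := posdef_Cholesky h_pos.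
elim: q => [|q IHq]; split; do ?by move=> *; rewrite form_hermDZr.
- by move=> u v; apply: form_hermC; case: h_pos.
- by move=> u /=; rewrite mulrC -normCK exprn_ge0.
- by move=> u v; apply: form_hermC; case: h_pos.
move=> al /=; apply: mulr_ge0; first by rewrite invr_ge0 ler0n.
pose be k : spinor R m := \sum_i (P k i)%:C%C *: interior_prod (basis_vec i) al.
rewrite (_ : \sum_i _ = \sum_k form_herm h q (be k) (be k)).
  by apply: sumr_ge0 => k _; exact: (psd_form_ge0 IHq).
under [RHS]eq_bigr => k _ do rewrite (psd_form_lincomb IHq).
rewrite [RHS]exchange_big; apply: eq_bigr => i _ /=; rewrite [RHS]exchange_big.
apply: eq_bigr => j _ /=; rewrite -mulr_suml hE mxE rmorph_sum; congr (_ * _).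
apply: eq_bigr => k _; rewrite mxE rmorphM; congr (_ * _).
exact/esym/conjc_real.
Qed.

(** The first clause of [form_0s]; unlike the third, it is preserved by every
    linear change of basis. *)
Definition multilinear al : Prop :=
  forall us vs (c : R) v w,
    al (us ++ (c *: v + w) :: vs) =
    c%:C%C * al (us ++ v :: vs) + al (us ++ w :: vs).

Lemma multilinear_interior_prod v al :
  multilinear al -> multilinear (interior_prod v al).
Proof. by move=> al_lin us; exact: (al_lin (v :: us)). Qed.

Lemma interior_prod_sum al I (r : seq I) (c : I -> R) (v : I -> 'rV[R]_m) :
  multilinear al ->
  interior_prod (\sum_(i <- r) c i *: v i) al =
  \sum_(i <- r) (c i)%:C%C *: interior_prod (v i) al.
Proof.
move=> al_lin.
have al0 : interior_prod 0 al = 0.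
  apply/funext => vs; have := al_lin [::] vs (-1) 0 0; rewrite /= scaler0 addr0.
  by rewrite /interior_prod rmorphN1 mulN1r addNr.
elim: r => [|i r IHr]; first by rewrite !big_nil.
rewrite !big_cons -IHr; apply/funext => vs; exact: (al_lin [::]).
Qed.

(** Contracting the pullback of a form with e_i is pulling back its contraction
    with e_i J = sum_p J_ip e_p; so the Gram matrix h of degree one turns into
    J^T h J, and the remaining degrees follow by induction. *)
Lemma form_herm_change_basis h J q al be :
  posdef (J^T *m h *m J) -> multilinear al -> multilinear be ->
  form_herm h q (fun vs => al [seq v *m J | v <- vs])
                (fun vs => be [seq v *m J | v <- vs]) =
  form_herm (J^T *m h *m J) q al be.
Proof.
move=> h'_pos; elim: q al be => [|q IHq] al be al_lin be_lin //=.
congr (_ * _).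
have basisJ i : basis_vec i *m J = \sum_p J i p *: basis_vec p.
  by rewrite -rowE [LHS]row_sum_delta; apply: eq_bigr => p _; rewrite mxE.
have ipJ i (ga : spinor R m) : multilinear ga ->
    interior_prod (basis_vec i) (fun vs => ga [seq v *m J | v <- vs]) =
    fun vs => (\sum_p (J i p)%:C%C *: interior_prod (basis_vec p) ga)
                [seq v *m J | v <- vs].
  by move=> ga_lin; rewrite -interior_prod_sum // -basisJ.
have sum_lin (ga : spinor R m) i : multilinear ga ->
    multilinear (\sum_p (J i p)%:C%C *: interior_prod (basis_vec p) ga).
  by move=> ga_lin; rewrite -interior_prod_sum //; exact: multilinear_interior_prod.
pose G p r := form_herm (J^T *m h *m J) q
  (interior_prod (basis_vec p) al) (interior_prod (basis_vec r) be).
transitivity (\sum_(ij : 'I_m * 'I_m) \sum_(pr : 'I_m * 'I_m)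
    (J ij.1 pr.1 * h ij.1 ij.2 * J ij.2 pr.2)%:C%C * G pr.1 pr.2).
  rewrite pair_bigA; apply: eq_bigr => -[i j] _ /=.
  rewrite !ipJ // IHq; [|exact: sum_lin..].
  rewrite (psd_form_lincomb (form_herm_psd q h'_pos)) pair_bigA mulr_sumr.
  apply: eq_bigr => -[p r] _ /=.
  rewrite -[(_ -i* _)%C]/((J i p)%:C^*)%C conjc_real !rmorphM /= /G; ring.
rewrite exchange_big [RHS]pair_bigA; apply: eq_bigr => -[p r] _ /=.
rewrite -mulr_suml -rmorph_sum; congr (_%:C%C * _).
rewrite mxE -(pair_bigA _ (fun i j => J i p * h i j * J j r)) exchange_big.
apply: eq_bigr => j _; rewrite mxE mulr_suml; apply: eq_bigr => i _.
by rewrite mxE.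
Qed.

End FormHerm.

Lemma ccontinuous_form_herm (R : realType) m (T : topologicalType)
    (h : T -> 'M[R]_m) q (al be : T -> spinor R m) x :
  (forall i j, {for x, continuous (fun z => h z i j)}) ->
  (forall vs, ccontinuous_at (fun z => al z vs) x) ->
  (forall vs, ccontinuous_at (fun z => be z vs) x) ->
  ccontinuous_at (fun z => form_herm (h z) q (al z) (be z)) x.
Proof.
move=> h_cont; elim: q al be => [|q IHq] al be al_cont be_cont /=.
  by apply: ccontinuousM => //; exact: ccontinuous_conj.
apply: ccontinuousM; first exact: ccontinuous_cst.
apply: ccontinuous_sum => i _; apply: ccontinuous_sum => j _.
apply: ccontinuousM; first exact: ccontinuous_real.
by apply: IHq => vs; [exact: al_cont | exact: be_cont].
Qed.

(** * Functions on the manifold read in charts *)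

Section Charts.
Context {R : realType} {m : nat} {M : topologicalType} {X : atlas R m M}.
Implicit Types (a : chart X) (y : 'rV[R]_m) (x : M).

Lemma img_chart a x : dom X a x -> img a (chart_map X a x).
Proof. by move=> ax; exists x. Qed.

Lemma csmooth_ccontinuous (V : set 'rV[R]_m) (f : 'rV[R]_m -> R[i]) y :
  csmooth V f -> V y -> ccontinuous_at f y.
Proof.
by move=> [fr fi] Vy; split; [case: (fr 0%N) | case: (fi 0%N)] => /(_ y Vy).
Qed.

(** Reduces continuity at x to a fixed chart; the hypothesis on f is what
    independence of the chart provides. *)
Lemma ccontinuous_chart (f : M -> R[i]) (g : 'rV[R]_m -> R[i]) a x :
  dom X a x -> (forall z, dom X a z -> f z = g (chart_map X a z)) ->
  ccontinuous_at g (chart_map X a x) -> ccontinuous_at f x.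
Proof.
move=> ax fg g_cont.
have : ccontinuous_at (fun z => g (chart_map X a z)) x.
  exact: ccontinuous_comp (Defs.coord_continuous ax) g_cont.
apply: ccontinuous_near.
have : nbhs x (dom X a) by apply: open_nbhs_nbhs; split=> //; exact: dom_open.
by apply: filterS => z /fg.
Qed.

End Charts.

(** * The metric and the Hermitian structures on sections *)

Section Metric.
Context {R : realType} {n : nat} {M : topologicalType}.
Context {X : atlas R (n + n) M} (K : almost_kahler X).
Implicit Types (a b : chart X) (y : 'rV[R]_(n + n)) (x : M).

Lemma acs_unit a y : img a y -> acs K a y \in unitmx.
Proof.
move=> ay; have /mulmx1_unit[] // : acs K a y *m (- acs K a y) = 1%:M.
by rewrite mulmxN acs_sq // opprK.
Qed.

Lemma metric_unit a y : img a y -> metric K a y \in unitmx.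
Proof. by move=> ay; rewrite unitmx_mul unitmx_tr omega_nondeg //= acs_unit. Qed.

(** Symmetry is J-invariance of omega: J omega J^T = omega and J^2 = -1 give
    J omega = - omega J^T.  Positivity is tameness. *)
Lemma metric_posdef a y : img a y -> posdef (metric K a y).
Proof.
move=> ay; split=> [|v v_neq0]; last first.
  by have := acs_tame K ay v_neq0; rewrite /bil /metric trmx_mul !mulmxA.
rewrite /metric trmx_mul trmxK omega_alt // mulmxN.
rewrite -[in RHS](acs_symplectic K ay) -mulmxA -trmx_mul acs_sq //.
by rewrite linearN /= trmx1 mulmxN mulmx1.
Qed.

Lemma cometric_posdef a y : img a y -> posdef (cometric K a y).
Proof.
by move=> ay; apply: posdef_invmx; [exact: metric_unit | exact: metric_posdef].
Qed.

Lemma metric_tensor a b x : dom X a x -> dom X b x ->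
  metric K a (chart_map X a x) =
  jac a b x *m metric K b (chart_map X b x) *m (jac a b x)^T.
Proof.
move=> ax bx; rewrite /metric (omega_tensor K ax bx) -!mulmxA -!trmx_mul.
by rewrite (acs_tensor K ax bx).
Qed.

Lemma cometric_tensor a b x : dom X a x -> dom X b x ->
  cometric K b (chart_map X b x) =
  (jac a b x)^T *m cometric K a (chart_map X a x) *m jac a b x.
Proof.
move=> ax bx; apply: invmx_congruence; first exact: metric_tensor.
exact/metric_unit/img_chart.
Qed.

Lemma continuous_cometric a y : img a y ->
  forall i j, {for y, continuous (fun z => cometric K a z i j)}.
Proof.
move=> ay; apply: continuous_invmx.
  have : nbhs y (img a) by apply: open_nbhs_nbhs; split=> //; exact: img_open.
  by apply: filterS => z; exact: metric_unit.
move=> i j; rewrite /metric.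
apply: continuous_mulmx => p q; first by case: (omega_smooth K a p q 0%N) => /(_ y ay).
rewrite (_ : (fun z => _) = fun z => acs K a z q p).
  by case: (acs_smooth K a q p 0%N) => /(_ y ay).
by apply/funext => z; rewrite mxE.
Qed.

Context (L : prequantum K) (k : nat).

Lemma tran_expn_unitary a b x : dom X a x -> dom X b x ->
  ((tran L a b x ^+ k)^*)%C * tran L a b x ^+ k = 1.
Proof. by move=> ax bx; rewrite rmorphXn -exprMn tran_unitary // expr1n. Qed.

(** The transition functions have modulus 1, so near x the product can be
    computed in the chart chosen at x, where the components are smooth. *)
Lemma line_herm_continuous (s t : sections X R[i]^o) :
  line_section L k s -> line_section L k t ->
  forall x, ccontinuous_at (line_herm s t) x.
Proof.
move=> [_ s_smooth s_tran] [_ t_smooth t_tran] x.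
have ax := chart_atP X x; set a := chart_at X x in ax *.
apply: (ccontinuous_chart (g := fun y => (s a y)^*%C * t a y) (a := a)) => // [z az|].
  have bz := chart_atP X z; rewrite (s_tran _ _ _ az bz) (t_tran _ _ _ az bz).
  by rewrite rmorphM mulrACA tran_expn_unitary // mul1r.
have ay := img_chart ax.
apply: ccontinuousM; first apply: ccontinuous_conj.
  exact: csmooth_ccontinuous (s_smooth a) ay.
exact: csmooth_ccontinuous (t_smooth a) ay.
Qed.

(** The product on spinors at a point of a given chart; [spinor_herm] evaluates
    it in the chart chosen at each point. *)
Definition spinor_form a y (al be : spinor R (n + n)) : R[i] :=
  \sum_(q < (n + n).+1) form_herm (cometric K a y) q al be.

Lemma spinor_form_psd a y : img a y -> psd_form (spinor_form a y).
Proof.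
move=> ay; apply: psd_form_sum => q; apply: form_herm_psd; exact: cometric_posdef.
Qed.

(** Components in a are the pullback by the Jacobian matrix J of those in b,
    times a number of modulus 1, and the cometrics satisfy h_b = J^T h_a J. *)
Lemma spinor_form_chart (s t : sections X (spinor R (n + n))) a b x :
  spinor_section L k s -> spinor_section L k t -> dom X a x -> dom X b x ->
  spinor_form a (chart_map X a x) (s a (chart_map X a x)) (t a (chart_map X a x)) =
  spinor_form b (chart_map X b x) (s b (chart_map X b x)) (t b (chart_map X b x)).
Proof.
move=> [_ _ s_tran s_form] [_ _ t_tran t_form] ax bx.
have ga := cometric_posdef (img_chart ax).
have gb := cometric_posdef (img_chart bx).
set ya := chart_map X a x in ga *; set yb := chart_map X b x in gb *.
pose pull (al : spinor R (n + n)) : spinor R (n + n) :=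
  fun vs => al [seq v *m jac a b x | v <- vs].
have -> : s a ya = tran L a b x ^+ k *: pull (s b yb).
  by apply/funext => vs; exact: s_tran.
have -> : t a ya = tran L a b x ^+ k *: pull (t b yb).
  by apply/funext => vs; exact: t_tran.
apply: eq_bigr => q _; have psd := form_herm_psd q ga.
rewrite (psd_formZl psd) (psd_formZr psd) mulrA tran_expn_unitary // mul1r.
move: gb; rewrite /yb (cometric_tensor ax bx) -/yb => gb.
rewrite form_herm_change_basis //.
- by case: (s_form b yb (img_chart bx)).
- by case: (t_form b yb (img_chart bx)).
Qed.

Lemma spinor_herm_continuous (s t : sections X (spinor R (n + n))) :
  spinor_section L k s -> spinor_section L k t ->
  forall x, ccontinuous_at (spinor_herm K s t) x.
Proof.
move=> s_sec t_sec x; have ax := chart_atP X x; set a := chart_at X x in ax *.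
have ay := img_chart ax.
apply: (ccontinuous_chart (g := fun y => spinor_form a y (s a y) (t a y)) (a := a))
  => // [z az|].
  by rewrite (spinor_form_chart s_sec t_sec az (chart_atP X z)).
apply: ccontinuous_sum => q _; apply: ccontinuous_form_herm => [i j|vs|vs].
- exact: continuous_cometric.
- by case: s_sec => _ s_smooth _ _; exact: csmooth_ccontinuous (s_smooth a vs) ay.
- by case: t_sec => _ t_smooth _ _; exact: csmooth_ccontinuous (t_smooth a vs) ay.
Qed.

End Metric.

(** * The coherent density bound for the three quantizations *)

Theorem theorem3p8 (R : realType) (n : nat) (M : ptopologicalType)
    (M_compact : compact [set: M]) (M_hausdorff : hausdorff_space M)
    (X : atlas R (n + n) M) (K : almost_kahler X) (L : prequantum K)
    (mu : {measure set (borel M) -> \bar R}) (mu_liouville : liouville K mu)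
    (A C : R) (A_gt0 : 0 < A)
    (k d : nat) (d_riemann_roch : riemann_roch K mu k = d%:R) :
  (integrable_acs K ->
   forall theta : 'I_d -> sections X (R[i]^o)%type,
   orthonormal_basis mu line_herm (holomorphic L k) theta ->
   forall s, holomorphic L k s ->
   forall x : M,
     ptnorm line_herm s x <=
     l2norm mu line_herm s *
     Num.sqrt (coherent_density line_herm theta x))
  /\
  (forall (psi : 'I_d -> sections X (R[i]^o)%type) (lam : 'I_d -> R),
   first_eigensections mu L k psi lam ->
   spectral_gap mu L k psi lam A C ->
   forall theta : 'I_d -> sections X (R[i]^o)%type,
   orthonormal_basis mu line_herm (lin_span psi) theta ->
   forall s, lin_span psi s ->
   forall x : M,
     ptnorm line_herm s x <=
     l2norm mu line_herm s *
     Num.sqrt (coherent_density line_herm theta x))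
  /\
  ((forall s, ker_dirac_minus L k s -> s = (fun _ _ => 0)) ->
   forall theta : 'I_d -> sections X (spinor R (n + n)),
   orthonormal_basis mu (spinor_herm K) (ker_dirac_plus L k) theta ->
   forall s, ker_dirac_plus L k s ->
   forall x : M,
     ptnorm (spinor_herm K) s x <=
     l2norm mu (spinor_herm K) s *
     Num.sqrt (coherent_density (spinor_herm K) theta x)).
Proof.
have line_psd (x : M) := psd_form_conj_mul R.
split; [move=> _ theta [theta_hol theta_on span] s /span s_span x|split].
- have theta_sec i : line_section L k (theta i) by case: (theta_hol i).
  have theta_cont i j := line_herm_continuous (theta_sec i) (theta_sec j).
  exact: (coherent_density_bound line_psd theta_cont theta_on s_span).
- move=> psi lam [psi_on psi_eig _ _] _ theta [theta_psi theta_on span] s /span s_span x.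
  have psi_sec i : line_section L k (psi i) by case: (psi_eig i).
  have psi_cont i j := line_herm_continuous (psi_sec i) (psi_sec j).
  have theta_cont i j :=
    ccontinuous_lincomb line_psd psi_cont (theta_psi i) (theta_psi j).
  exact: (coherent_density_bound line_psd theta_cont theta_on s_span).
move=> _ theta [theta_ker theta_on span] s /span s_span x.
have theta_sec i : spinor_section L k (theta i) by case: (theta_ker i) => -[].
have theta_cont i j := spinor_herm_continuous (theta_sec i) (theta_sec j).
have spinor_psd (z : M) := spinor_form_psd K (img_chart (chart_atP X z)).
exact: (coherent_density_bound spinor_psd theta_cont theta_on s_span).
Qed.
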